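(* There is an infinite family of trees $T_n$, $n>0$, such that any labeled fixed-port routing scheme with stretch 1 on the metric induced by $T_n$ has at least one vertex with total memory of $\Omega(\log^2 n/\log\log n)$ bits.
   Context: The metric induced by a tree $T=(V,E)$ is $(V,d_T)$ with $d_T$ the shortest-path distance; routing may use any pair of vertices as an edge (weighted by $d_T$). A labeled routing scheme assigns each vertex a routing table and a label chosen by the designer; a packet to destination $v$ carries a header containing the label of $v$, and at each vertex $u$ the next edge (given by a port number) is determined from $u$'s table and the header. In the fixed-port model port numbers are assigned adversarially. Stretch 1 means every routed path has length equal to the distance between source and destination. Total memory of a vertex is the number of bits in its routing table and label; $n$ denotes the number of vertices. *)

(* Defs.v *)
From mathcomp Require Import all_boot.

Set Implicit Arguments.
Unset Strict Implicit.
Unset Printing Implicit Defensive.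

(* In a symmetric graph a single edge is an e-cycle [:: x; y], so a genuine
   cycle is a duplicate-free e-cycle with at least three vertices. *)
Definition is_tree (V : finType) (e : rel V) : Prop :=
  [/\ 0 < #|V|, symmetric e, irreflexive e,
      forall x y : V, connect e x y
    & forall s : seq V, ucycle e s -> size s <= 2].

(* Shortest-path distance. A shortest path has fewer than #|V| edges; the
   value is #|V| if x and y are not connected. *)
Definition graph_dist (V : finType) (e : rel V) (x y : V) : nat :=
  find (fun k : nat => [exists q : k.-tuple V, path e x q && (last x q == y)])
       (iota 0 #|V|).

Definition bits := seq bool.

(* p u w is the port number, at u, of the edge {u, w}; the value is irrelevant
   when w is not a neighbour of u. *)
Definition ports (V : finType) := V -> V -> nat.

(* At each vertex u the edges are numbered bijectively by 0, ..., deg(u) - 1. *)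
Definition port_assignment (V : finType) (H : rel V) (p : ports V) : Prop :=
  forall u : V,
    {in [set w | H u w] &, injective (p u)} /\
    (forall w : V, H u w -> p u w < #|[set w' | H u w']|).

(* A labeled fixed-port routing scheme on a metric with point set V. The
   overlay is the set of pairs used as edges (possibly all of them); it is fixed
   before the ports are. Tables and labels are computed knowing the ports, but
   the forwarding function is not: it sees only the table of the current vertex
   and the header. A header is a pair (label of the destination, extra
   information); forwarding returns a port and the rewritten extra part. *)
Record routing_scheme (V : finType) := RoutingScheme {
  overlay : rel V;
  overlay_sym : symmetric overlay;
  overlay_irrefl : irreflexive overlay;
  table : ports V -> V -> bits;
  label : ports V -> V -> bits;
  forward : bits -> bits * bits -> nat * bits
}.

Definition total_memory (V : finType) (S : routing_scheme V) (p : ports V)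
    (u : V) : nat :=
  size (table S p u) + size (label S p u).

(* routed S p d v u x l: a packet for v that is at u, with extra header part x,
   is forwarded to v along a path of length l, an edge {a, b} weighing d a b. *)
Inductive routed (V : finType) (S : routing_scheme V) (p : ports V)
    (d : V -> V -> nat) (v : V) : V -> bits -> nat -> Prop :=
| Arrived (x : bits) : routed S p d v v x 0
| Hop (u w : V) (x x' : bits) (l : nat) :
    u != v ->
    overlay S u w ->
    forward S (table S p u) (label S p v, x) = (p u w, x') ->
    routed S p d v w x' l ->
    routed S p d v u x (d u w + l).

(* The extra part of the header is empty when the packet leaves its source. *)
Definition stretch1 (V : finType) (d : V -> V -> nat) (S : routing_scheme V) :
    Prop :=
  forall p : ports V, port_assignment (overlay S) p ->
  forall u v : V, routed S p d v u [::] (d u v).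

(* Main.v *)
Require Import Defs.
From mathcomp Require Import all_boot all_order all_algebra.
From mathcomp Require Import zify lra.
From mathcomp Require Import boolp reals exp.

(* The hard tree is a complete tree of polylogarithmic branching b and depth
   k ~ log n / log log n, each vertex of which carries polynomially many extra
   leaves; stretch 1 puts every tree edge in the overlay, so each of these
   vertices has many ports. A packet from u to a skeleton vertex below its child
   c must first hop to a skeleton vertex below c, and the adversary gives all of
   these ports inside one small block of u's port range. By counting, the blocks
   of the b children can be chosen, top-down, so that whatever the tables of u
   and its ancestors are, some child's block receives at most a fraction 1/s of
   the labels that were routed correctly by the ancestors, with s a power of n.
   Walking down to such children, 2^M possible labels shrink to 2^M / s^k, and
   the label of the vertex reached is among them; hence M >= k log s. *)

Set Implicit Arguments.
Unset Strict Implicit.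
Unset Printing Implicit Defensive.

(** * Distances and first hops *)

Section GraphDistance.
Variables (V : finType) (e : rel V).
Local Notation dist := (graph_dist e).

Lemma graph_dist_le_size x q : path e x q -> dist x (last x q) <= size q.
Proof.
move=> xq; rewrite leqNgt; apply/negP => lt_q.
have q_lt : size q < #|V|.
  by apply: leq_trans lt_q _; rewrite -[leqRHS](size_iota 0) find_size.
have := before_find 0 lt_q; rewrite nth_iota // add0n => /existsP[].
by exists (in_tuple q); rewrite xq eqxx.
Qed.

Lemma graph_dist_path x y : connect e x y ->
  exists q, [/\ path e x q, last x q = y & size q = dist x y].
Proof.
move=> /connectP[q0 xq0 ->]; case/shortenP: xq0 => q xq uq _.
have q_lt : size q < #|V| by have := max_card (mem (x :: q)); rewrite (card_uniqP uq).
have hasd : has (fun k : nat => [exists p : k.-tuple V,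
    path e x p && (last x p == last x q)]) (iota 0 #|V|).
  apply/hasP; exists (size q); first by rewrite mem_iota.
  by apply/existsP; exists (in_tuple q); rewrite xq eqxx.
have := nth_find 0 hasd; rewrite nth_iota; last first.
  by move: hasd; rewrite has_find size_iota.
rewrite add0n => /existsP[p /andP[xp /eqP lp]].
by exists p; rewrite size_tuple.
Qed.

Lemma graph_distxx x : dist x x = 0.
Proof. by apply/eqP; rewrite -leqn0 (@graph_dist_le_size x [::]). Qed.

Hypothesis conn : forall x y, connect e x y.

Lemma graph_dist_eq0 x y : dist x y = 0 -> x = y.
Proof.
by have [q [_ <- <-]] := graph_dist_path (conn x y) => /size0nil ->.
Qed.

Lemma graph_dist_triangle x y z : dist x z <= dist x y + dist y z.
Proof.
have [q [xq lq <-]] := graph_dist_path (conn x y).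
have [r [yr lr <-]] := graph_dist_path (conn y z).
by rewrite -size_cat -lr -lq -last_cat graph_dist_le_size // cat_path xq lq.
Qed.

Lemma graph_dist_sym (e_sym : symmetric e) x y : dist x y = dist y x.
Proof.
suff le_d a b : dist b a <= dist a b by apply/eqP; rewrite eqn_leq !le_d.
have [q [aq <- <-]] := graph_dist_path (conn a b).
have lr : last (last a q) (rev (belast a q)) = a.
  by case: q {aq} => //= z q; rewrite rev_cons last_rcons.
rewrite -{2}lr -(size_belast a q) -size_rev graph_dist_le_size // rev_path.
by rewrite (eq_path (e' := e)).
Qed.

(** [u] is the only gate into [A], so every path from [x] to [y] splits at [u]. *)
Lemma graph_dist_cut (A : V -> Prop) u x y :
    (forall z z', ~ A z -> A z' -> e z z' -> z = u) ->
  ~ A x -> A y -> dist x u + dist u y <= dist x y.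
Proof.
move=> Au nAx Ay; have [q [xq lq <-]] := graph_dist_path (conn x y).
have : u \in x :: q.
  rewrite -lq in Ay; apply/negPn/negP => uq {lq}.
  elim: q x xq nAx Ay uq => //= z q IHq x /andP[exz zq] nAx Ay uq.
  apply: IHq zq _ Ay _ => [Az|]; last first.
    by apply: contra uq; rewrite [in X in _ -> X]inE => ->; rewrite orbT.
  by rewrite (Au x z) ?inE ?eqxx in uq.
move=> uq; rewrite -lq; case/splitPl: uq xq => q1 q2 lu.
rewrite cat_path last_cat lu size_cat => /andP[xq1 uq2].
by rewrite leq_add ?graph_dist_le_size // -lu graph_dist_le_size.
Qed.

Lemma routed_ge_dist (S : routing_scheme V) p v u x l :
  routed S p dist v u x l -> dist u v <= l.
Proof.
elim=> [y|a w y y' m _ _ _ _ IH]; first by rewrite graph_distxx.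
by apply: leq_trans (graph_dist_triangle a w v) _; rewrite leq_add2l.
Qed.

(** Stretch 1 is exploited only through this: what follows the first hop costs at least the
    remaining distance. *)
Lemma routed_first_hop (S : routing_scheme V) p v u x l :
    routed S p dist v u x l -> u != v ->
  exists w, [/\ overlay S u w,
    (forward S (table S p u) (label S p v, x)).1 = p u w
  & dist u w + dist w v <= l].
Proof.
case=> [y|a w y y' m _ aw fw rt]; first by rewrite eqxx.
by exists w; rewrite aw fw leq_add2l (routed_ge_dist rt).
Qed.

End GraphDistance.

(** * Trees given by a parent map *)

Section ParentTree.
Variables (V : finType) (par : V -> V) (root : V) (h : V -> nat).

Definition parent_rel : rel V :=
  fun x y => (x != y) && ((x == par y) || (y == par x)).

Lemma parent_rel_sym : symmetric parent_rel.
Proof. by move=> x y; rewrite /parent_rel eq_sym orbC. Qed.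

Lemma parent_rel_irrefl : irreflexive parent_rel.
Proof. by move=> x; rewrite /parent_rel eqxx. Qed.

Hypothesis par_root : par root = root.
Hypothesis par_lt : forall x, x != root -> h (par x) < h x.

Lemma parent_neq x : x != root -> par x != x.
Proof. by move=> /par_lt; apply: contraTneq => ->; rewrite ltnn. Qed.

Lemma parent_rel_connect x y : connect parent_rel x y.
Proof.
have toroot z : connect parent_rel z root.
  have [m] := ubnP (h z); elim: m z => // m IHm z /ltnSE hz.
  have [->|zr] := eqVneq z root; first exact: connect0.
  apply: (@connect_trans _ _ (par z)); last first.
    by apply: IHm; apply: leq_trans hz; apply: par_lt.
  by apply: connect1; rewrite /parent_rel eq_sym parent_neq // eqxx orbT.
apply: connect_trans (toroot x) _.
by rewrite (sym_connect_sym parent_rel_sym).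
Qed.

Lemma fconnect_root x : fconnect par x root.
Proof.
have [m] := ubnP (h x); elim: m x => // m IHm x /ltnSE hx.
have [->|xr] := eqVneq x root; first exact: connect0.
apply: connect_trans (fconnect1 _ _) _.
by apply: IHm; apply: leq_trans hx; apply: par_lt.
Qed.

Lemma parent_rel_acyclic s : ucycle parent_rel s -> size s <= 2.
Proof.
case: s => // x0 s0; set s := x0 :: s0 => /andP[cs us].
pose x := [arg max_(i > x0 in s) h i].
have [xs xmax] : x \in s /\ forall y, y \in s -> h y <= h x.
  by rewrite /x; case: arg_maxnP => [|i]; rewrite ?inE ?eqxx.
(* Both neighbours on the cycle of a vertex of maximal height are its parent. *)
have nbr y : y \in s -> parent_rel x y -> y = par x.
  move=> ys /andP[xy /orP[/eqP xE|/eqP//]].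
  have [yr|yr] := eqVneq y root; first by rewrite xE yr par_root eqxx in xy.
  by have := par_lt yr; rewrite -xE ltnNge xmax.
case: (rot_to xs) => i [|y [|z t]] rs.
- by rewrite -(size_rot i) rs.
- by rewrite -(size_rot i) rs.
have ss : {subset [:: x, y, z & t] <= s} by move=> a; rewrite -rs mem_rot.
move: cs us; rewrite -(rot_cycle i) -(rot_uniq i) rs /= rcons_path.
move=> /and4P[xy _ _ zx] /and3P[_ + _]; rewrite parent_rel_sym in zx.
have lz := mem_last z t.
rewrite (nbr y) ?ss ?inE ?eqxx ?orbT // -(nbr (last z t)) // -?in_cons ?lz //.
by apply: ss; rewrite 2!inE lz !orbT.
Qed.

Lemma parent_rel_tree : is_tree parent_rel.
Proof.
split; [by apply/card_gt0P; exists root | exact: parent_rel_sym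
       | exact: parent_rel_irrefl | exact: parent_rel_connect
       | exact: parent_rel_acyclic].
Qed.

Local Notation dist := (graph_dist parent_rel).

Lemma fconnect_parent x c : fconnect par x c -> x != c -> fconnect par (par x) c.
Proof.
move=> /iter_findex; case: (findex _ _ _) => [|i <- _] /=.
  by move=> ->; rewrite eqxx.
by rewrite -iterS iterSr fconnect_iter.
Qed.

(** [fconnect par x c] says that [c] is [x] or an ancestor of [x]. The subtree of [c] can be entered
    only from [par c]. *)
Lemma graph_dist_through_parent c x y :
    ~~ fconnect par x c -> fconnect par y c ->
  dist x (par c) + dist (par c) y <= dist x y.
Proof.
move=> /negP xc yc.
apply: (@graph_dist_cut _ _ parent_rel_connect (fun z => fconnect par z c)) => //.
move=> z z' zc z'c /andP[zz' /orP[/eqP zE|/eqP z'E]]; last first.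
  by case: zc; apply: connect_trans z'c; rewrite z'E fconnect1.
have [<-//|z'nc] := eqVneq z' c.
by case: zc; rewrite zE fconnect_parent.
Qed.

(** If [w] is outside the subtree of [c], the way on to [v] returns to [par c]; if [v] is outside
    the subtree of [w], the edge from [w] to [par w] is counted twice. Either way the length is too
    large. *)
Lemma between_descendant c v w :
    fconnect par v c -> w != par c ->
    dist (par c) w + dist w v <= dist (par c) v ->
  fconnect par w c && fconnect par v w.
Proof.
move=> vc wc; have dsym := graph_dist_sym parent_rel_connect parent_rel_sym.
apply: contraTT; rewrite negb_and -ltnNge => /orP[nwc|nvw].
  have := graph_dist_through_parent nwc vc.
  have : 0 < dist w (par c).
    by rewrite lt0n; apply: contra_neq wc; apply: graph_dist_eq0 parent_rel_connect _ _.
  lia.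
have ncw : ~~ fconnect par (par c) w.
  apply: contra nvw => cw; apply: connect_trans vc _.
  exact: connect_trans (fconnect1 _ _) cw.
have := graph_dist_through_parent ncw (connect0 _ _).
have := graph_dist_through_parent nvw (connect0 _ _).
have := graph_dist_triangle parent_rel_connect (par c) (par w) v.
have : 0 < dist (par w) w.
  rewrite lt0n; apply: contraNneq nvw => /graph_dist_eq0 -/(_ parent_rel_connect) pw.
  have [->|/parent_neq] := eqVneq w root; first exact: fconnect_root.
  by rewrite pw eqxx.
rewrite (dsym v w) (dsym v (par w)); lia.
Qed.
End ParentTree.

(** * Counting *)

(** At least [#|A :\: B|] values are left free by [f] and serve the rest of [A]. Thus the adversary
    need prescribe only some of the ports. *)
Lemma extend_ports (V : finType) (A B : {set V}) (f : V -> nat) :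
    B \subset A -> {in B &, injective f} -> {in B, forall w, f w < #|A|} ->
  exists g : V -> nat, [/\ {in A &, injective g},
    {in A, forall w, g w < #|A|} & {in B, g =1 f}].
Proof.
move=> BA finj flt; pose fB := [seq f w | w <- enum B].
pose R := [seq i <- iota 0 #|A| | i \notin fB].
have szR : #|A :\: B| <= size R.
  have le_fB : size [seq i <- iota 0 #|A| | i \in fB] <= #|B|.
    have -> : #|B| = size fB by rewrite size_map cardE.
    rewrite uniq_leq_size ?filter_uniq ?iota_uniq // => i.
    by rewrite mem_filter => /andP[].
  have := count_predC [in fB] (iota 0 #|A|); rewrite -!size_filter size_iota.
  by have := cardsID B A; rewrite (setIidPr BA) -/R; move: le_fB; rewrite /R; lia.
pose D := enum (A :\: B).
have idx w : w \in A -> w \notin B -> index w D < size R.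
  move=> wA wB; apply: leq_trans szR; rewrite cardE index_mem mem_enum inE wA.
  by rewrite wB.
have memR w : w \in A -> w \notin B -> nth 0 R (index w D) \in R.
  by move=> wA wB; rewrite mem_nth ?idx.
have memfB w : w \in B -> f w \in fB by move=> wB; rewrite map_f ?mem_enum.
exists (fun w => if w \in B then f w else nth 0 R (index w D)); split=> [w w'|w|w].
- move=> wA w'A; have [wB|wB] := boolP (w \in B); have [w'B|w'B] := boolP (w' \in B).
  + exact: finj.
  + by move=> E; have := memR _ w'A w'B; rewrite -E mem_filter memfB.
  + by move=> E; have := memR _ wA wB; rewrite E mem_filter memfB.
  + move/eqP; rewrite nth_uniq ?idx ?filter_uniq ?iota_uniq // => /eqP.
    by apply: (index_inj w); rewrite mem_enum inE ?wA ?wB ?w'A ?w'B.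
- move=> wA; case: ifPn => [/flt//|wB].
  by have := memR _ wA wB; rewrite mem_filter mem_iota => /andP[_ /andP[]].
- by move=> ->.
Qed.

Section BlockChoice.
Variables (b s Q : nat).

(** [D] lists the blocks to which labels are sent; the [Q] consecutive blocks from [r * Q] on are
    reserved for child [r]. Heavy means receiving more than a fraction [1/s] of [D]. *)
Definition heavy_blocks (D : seq nat) (r : nat) : {set 'I_Q} :=
  [set q : 'I_Q | size D < s * count_mem (r * Q + q) D].

Lemma sum_count_mem_inj (I : finType) (A : {set I}) (f : I -> nat) (D : seq nat) :
  injective f -> \sum_(i in A) count_mem (f i) D <= size D.
Proof.
move=> finj; elim: D => [|d D IHD] /=; first by rewrite big1.
rewrite big_split /= -add1n leq_add //.
have [i0 /eqP <-|nod] := pickP [pred i | f i == d]; last first.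
  by rewrite big1 // => i _; have := nod i; rewrite /= eq_sym => ->.
rewrite (bigID (pred1 i0)) /= [X in _ + X]big1 => [|i /andP[_ /negPf ii0]].
  rewrite addn0 (eq_bigr (fun=> 1)) => [|i /andP[_ /eqP->]]; last by rewrite eqxx.
  rewrite sum1_card; apply: leq_trans (subset_leq_card _) (eq_leq (card1 i0)).
  by apply/subsetP => i /andP[].
by rewrite (inj_eq finj) eq_sym ii0.
Qed.

Lemma card_heavy_blocks D r : #|heavy_blocks D r| <= s.
Proof.
have inj_q : injective (fun q : 'I_Q => r * Q + q).
  by move=> q q' /addnI/val_inj.
have := sum_count_mem_inj (heavy_blocks D r) D inj_q.
(* Each heavy block has more than [size D / s] entries of [D], and distinct blocks share none. *)
have : #|heavy_blocks D r| * (size D).+1 <=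
       s * \sum_(q in heavy_blocks D r) count_mem (r * Q + q) D.
  rewrite -sum_nat_const big_distrr leq_sum // => q.
  by rewrite inE.
nia.
Qed.

(* A choice of blocks that is bad for [D] uses heavy blocks only, and
   there are at most [s ^ b] such choices. *)
Lemma light_block_choice (fam : seq (seq nat)) : size fam * s ^ b < Q ^ b ->
  exists beta : nat -> nat, (forall r, r < b -> beta r < Q) /\
    (forall D, D \in fam ->
       exists2 r, r < b & s * count_mem (r * Q + beta r) D <= size D).
Proof.
move=> lt_fam.
pose bad D : {set {ffun 'I_b -> 'I_Q}} :=
  [set B : {ffun 'I_b -> 'I_Q} | B \in family (fun r : 'I_b => mem (heavy_blocks D r))].
have card_bad D : #|bad D| <= s ^ b.
  rewrite cardsE card_family -[X in s ^ X](card_ord b) -prod_nat_const.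
  rewrite foldrE big_map big_enum leq_prod // => r _.
  exact: card_heavy_blocks.
pose U := \bigcup_(D <- fam) bad D.
have [B nB] : exists B, B \notin U.
  have : #|U| < #|{ffun 'I_b -> 'I_Q}|.
    rewrite card_ffun !card_ord; apply: leq_ltn_trans lt_fam.
    rewrite {}/U; elim: fam => [|D fam IH]; first by rewrite big_nil cards0.
    by rewrite big_cons /= mulSn (leq_trans (leq_card_setU _ _)) // leq_add.
  case: (pickP [pred B | B \notin U]) => [B|allU]; first by exists B.
  by rewrite (eq_card (B := predT)) ?ltnn // => B; exact: negbFE (allU B).
exists (fun r => if (insub r : option 'I_b) is Some i then B i : nat else 0).
split=> [r rb|D Dfam].
  by rewrite insubT.
have : B \notin bad D.
  apply: contra nB; rewrite /U; elim: fam Dfam {lt_fam U} => // D' fam IH.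
  by rewrite in_cons big_cons in_setU => /orP[/eqP<- ->//|/IH{}IH /IH->]; rewrite orbT.
rewrite inE => /familyP nfam.
have [r] : exists r, B r \notin heavy_blocks D r.
  case: (pickP [pred r | B r \notin heavy_blocks D r]) => [r|allr]; first by exists r.
  by case: nfam => r; exact: negbFE (allr r).
rewrite inE -leqNgt => le_r; exists (r : nat) => //.
have E : insub (r : nat) = Some r :> option 'I_b by exact: valK.
by rewrite E.
Qed.
End BlockChoice.

(** Strings of length below [M]: they include the table and the label of any vertex of total memory
    below [M]. *)
Fixpoint short_bits (M : nat) : seq bits :=
  if M is M'.+1 then
    [::] :: [seq true :: l | l <- short_bits M'] ++
            [seq false :: l | l <- short_bits M']
  else [::].

Lemma size_short_bits M : (size (short_bits M)).+1 = 2 ^ M.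
Proof.
by elim: M => //= M IHM; rewrite size_cat !size_map expnS -IHM mul2n -addnn addSn addnS.
Qed.

Lemma mem_short_bits M l : size l < M -> l \in short_bits M.
Proof.
elim: M l => // M IHM [|[] l] //=; rewrite ltnS inE mem_cat => /IHM lM.
  by rewrite (map_f (cons true) lM) orbT.
by rewrite (map_f (cons false) lM) !orbT.
Qed.

Section LabelClasses.
Variables (fwd : bits -> bits -> nat) (W M : nat).

(* All the sets of labels that are sent through the blocks [h] (of [W] ports
   each) by some tables of the ancestors. *)
Fixpoint label_classes (h : seq nat) : seq (seq bits) :=
  if h is q :: h' then
    [seq [seq l <- L | fwd t l %/ W == q] | L <- label_classes h', t <- short_bits M]
  else [:: short_bits M].

(** The current vertex may have any table [t]; since tables are computed after the ports, the
    adversary must cope with all these profiles at once. *)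
Definition block_profiles (h : seq nat) : seq (seq nat) :=
  [seq [seq fwd t l %/ W | l <- L] | L <- label_classes h, t <- short_bits M].

Lemma size_label_classes h : size (label_classes h) <= 2 ^ (M * size h).
Proof.
elim: h => [|q h IHh] /=; first by rewrite muln0.
by rewrite size_allpairs mulnS expnD mulnC leq_mul // -size_short_bits.
Qed.

Lemma size_block_profiles h : size (block_profiles h) <= 2 ^ (M * (size h).+1).
Proof.
rewrite size_allpairs mulnS expnD mulnC leq_mul ?size_label_classes //.
by rewrite -size_short_bits.
Qed.

End LabelClasses.

(** * The hard tree *)

Section Heap.
Variable b : nat.

(** Paths are read from the vertex up to the root, so that moving to a child is a cons. *)
Fixpoint heap_node (sg : seq nat) : nat :=
  if sg is r :: sg' then heap_node sg' * b + r.+1 else 0.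

Fixpoint heap_path_rec (fuel x : nat) : seq nat :=
  match fuel, x with
  | fuel'.+1, x'.+1 => x' %% b :: heap_path_rec fuel' (x' %/ b)
  | _, _ => [::]
  end.

Definition heap_path (x : nat) : seq nat := heap_path_rec x x.

Lemma heap_path_rec_fuel fuel x : x <= fuel -> heap_path_rec fuel x = heap_path x.
Proof.
rewrite /heap_path; have [m] := ubnP x.
elim: m x fuel => // m IHm [|x] [|f] //= xm xf; congr (_ :: _).
have le_x : x %/ b <= x by exact: leq_div.
by rewrite !IHm //; lia.
Qed.

Lemma heap_pathS x : heap_path x.+1 = x %% b :: heap_path (x %/ b).
Proof. by rewrite {1}/heap_path /= heap_path_rec_fuel // leq_div. Qed.

Hypothesis b_gt1 : 1 < b.

Lemma heap_nodeK sg : all (ltn^~ b) sg -> heap_path (heap_node sg) = sg.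
Proof.
elim: sg => //= r sg IHsg /andP[rb sgb].
rewrite addnS heap_pathS modnMDl modn_small // divnMDl ?(ltnW b_gt1) //.
by rewrite divn_small // addn0 IHsg.
Qed.

Lemma heap_path_lt x : all (ltn^~ b) (heap_path x).
Proof.
have [m] := ubnP x; elim: m x => // m IHm [|x] // xm.
rewrite heap_pathS /= ltn_mod (ltnW b_gt1) IHm //.
exact: leq_ltn_trans (leq_div _ _) (xm : x < m).
Qed.

(** The offset 2 lets the induction close, because [b + 2 <= 2 * b]. *)
Lemma heap_node_bound sg :
  all (ltn^~ b) sg -> (heap_node sg).+2 <= 2 * b ^ size sg.
Proof.
elim: sg => //= r sg IHsg /andP[rb /IHsg]; rewrite expnS.
by move: (heap_node sg) (b ^ _) => x y; nia.
Qed.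

Variables (W n : nat) (W_gt0 : 0 < W).

(* The first [W] vertices form a complete [b]-ary tree numbered as a heap; the
   remaining ones are leaves evenly distributed below them. *)
Definition heap_parent (x : nat) : nat := if x < W then x.-1 %/ b else x %% W.

Lemma heap_parent_le x : heap_parent x <= x.
Proof.
rewrite /heap_parent; case: ifP => _; last exact: leq_mod.
exact: leq_trans (leq_div _ _) (leq_pred _).
Qed.

Definition heap_par (x : 'I_n) : 'I_n := insubd x (heap_parent x).

Lemma val_heap_par x : heap_par x = heap_parent x :> nat.
Proof.
by rewrite val_insubd (leq_ltn_trans (heap_parent_le x) (ltn_ord x)).
Qed.

Lemma heap_par_lt (x : 'I_n) : x != 0 :> nat -> heap_par x < x.
Proof.
rewrite val_heap_par /heap_parent; case: x => -[|x] //= _ _.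
case: ifPn => [_|]; first by rewrite ltnS leq_div.
by rewrite -leqNgt; apply: leq_trans; rewrite ltn_mod.
Qed.

Lemma heap_par0 (x : 'I_n) : x = 0 :> nat -> heap_par x = x.
Proof.
move=> x0; apply: val_inj; rewrite /= val_heap_par x0.
by apply/eqP; rewrite -leqn0 heap_parent_le.
Qed.

Definition heap_tree : rel 'I_n := parent_rel heap_par.

Lemma fconnect_heap_par_le v w : fconnect heap_par v w -> w <= v.
Proof.
move=> /iter_findex <-; elim: (findex _ _ _) => //= i; apply: leq_trans.
by rewrite val_heap_par heap_parent_le.
Qed.

Lemma heap_path_ancestor (w c : 'I_n) : w < W -> fconnect heap_par w c ->
  exists tau, heap_path w = tau ++ heap_path c.
Proof.
move=> wW /iter_findex <-; elim: (findex _ _ _) => [|i [tau ->]] /=.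
  by exists [::].
set x := iter i _ w; have xW : x < W.
  apply: leq_ltn_trans wW; apply: fconnect_heap_par_le; exact: fconnect_iter.
have [x0|] := eqVneq (x : nat) 0; first by exists tau; rewrite heap_par0.
rewrite val_heap_par /heap_parent xW; case: (x : nat) => // y _.
by exists (rcons tau (y %% b)); rewrite heap_pathS cat_rcons.
Qed.

End Heap.

Lemma heap_tree_is_tree b W n : 0 < W -> 0 < n -> is_tree (@heap_tree b W n).
Proof.
move=> W_gt0 n_gt0; pose root := Ordinal n_gt0.
apply: (@parent_rel_tree _ _ root val) => [|x]; first exact: heap_par0.
exact: heap_par_lt.
Qed.

Lemma heap_tree_connect b W n (W_gt0 : 0 < W) x y : connect (@heap_tree b W n) x y.
Proof.
by have [_ _ _ + _] := heap_tree_is_tree b W_gt0 (leq_ltn_trans (leq0n _) (ltn_ord x)).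
Qed.

Lemma heap_between b W n (W_gt0 : 0 < W) (v w c : 'I_n) :
    let par := @heap_par b W n in let dist := graph_dist (@heap_tree b W n) in
    fconnect par v c -> w != par c ->
    dist (par c) w + dist w v <= dist (par c) v ->
  fconnect par w c && fconnect par v w.
Proof.
have n_gt0 : 0 < n by apply: leq_ltn_trans (ltn_ord v).
move=> par dist; apply: (@between_descendant _ par (Ordinal n_gt0) val).
by move=> x; apply: heap_par_lt.
Qed.

(** * Overlay edges forced by stretch 1 *)

Lemma port_assignment_exists (V : finType) (H : rel V) :
  exists p, port_assignment H p.
Proof.
have ex u : exists g : V -> nat, {in [set w | H u w] &, injective g} /\
    (forall w, H u w -> g w < #|[set w' | H u w']|).
  have [w w'|w|g [ginj glt _]] :=
    @extend_ports _ [set w | H u w] set0 (fun=> 0) (sub0set _).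
  - by rewrite inE.
  - by rewrite inE.
  - by exists g; split=> // w uw; apply: glt; rewrite inE.
by have [p pP] := choice ex; exists p.
Qed.

(** The first hop [w] differs from [x], and [dist x w + dist w y <= 1] then leaves only [w = y]. *)
Lemma tree_edge_in_overlay b W n (W_gt0 : 0 < W) (S : routing_scheme 'I_n) :
  stretch1 (graph_dist (@heap_tree b W n)) S ->
  subrel (@heap_tree b W n) (overlay S).
Proof.
have conn := @heap_tree_connect b W n W_gt0.
move=> st1 x y xy.
have [p pA] := port_assignment_exists (overlay S).
have neq_xy : x != y by case/andP: xy.
have [w [xw _ le_w]] := routed_first_hop conn (st1 p pA x y) neq_xy.
have : graph_dist (@heap_tree b W n) x y <= 1.
  by apply: (@graph_dist_le_size _ _ x [:: y]); rewrite /= xy.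
have : 0 < graph_dist (@heap_tree b W n) x w.
  rewrite lt0n; apply: contraTneq xw => /(graph_dist_eq0 conn) <-.
  by rewrite overlay_irrefl.
move=> dxw dxy; rewrite -(@graph_dist_eq0 _ _ conn w y) //.
by apply/eqP; rewrite -leqn0; move: dxw dxy le_w; lia.
Qed.

(** The vertices [j.+1 * W + u] are leaves attached to [u]; they provide the port range in which the
    adversary places its blocks. *)
Lemma card_overlay_nbrs b W n m (W_gt0 : 0 < W) (S : routing_scheme 'I_n) (u : 'I_n) :
    stretch1 (graph_dist (@heap_tree b W n)) S -> u < W -> m.+1 * W <= n ->
  m <= #|[set w | overlay S u w]|.
Proof.
move=> st1 uW mW.
have lt_n (j : 'I_m) : j.+1 * W + u < n.
  by have := ltn_ord j; nia.
pose g (j : 'I_m) : 'I_n := Ordinal (lt_n j).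
have g_inj : injective g.
  move=> i j [/eqP]; rewrite eqn_add2r eqn_pmul2r // eqSS => /eqP.
  exact: val_inj.
rewrite -[m]card_ord -(card_codom g_inj); apply/subset_leq_card/subsetP.
move=> _ /codomP[j ->]; rewrite inE; apply: tree_edge_in_overlay st1 _ _ _ => //.
apply/andP; split.
  by rewrite -val_eqE /= neq_ltn; apply/orP; left; nia.
rewrite -(inj_eq val_inj) /= val_heap_par // /heap_parent /= ifN; last first.
  by rewrite -leqNgt; nia.
by rewrite modnMDl modn_small ?eqxx.
Qed.

Lemma block_port_lt b Q W r q w :
  r < b -> q < Q -> w < W -> (r * Q + q) * W + w < b * Q * W.
Proof.
move=> rb qQ wW; have : r * Q + q < b * Q by nia.
by move: (r * Q + q) (b * Q); nia.
Qed.

(** * The adversary *)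

Section Adversary.
Variables (b W s Q M k n : nat).
Hypotheses (b_gt1 : 1 < b) (W_gt0 : 0 < W) (kW : 2 * b ^ k <= W).
Hypotheses (deg_n : (b * Q * W).+1 * W <= n) (few : 2 ^ (M * k) * s ^ b < Q ^ b).
Hypothesis (Msk : 2 ^ M <= s ^ k).
Variable S : routing_scheme 'I_n.
Local Notation dist := (graph_dist (@heap_tree b W n)).
Hypothesis st1 : stretch1 dist S.
Local Notation par := (@heap_par b W n).

Let fwd (t l : bits) : nat := (forward S t (l, [::])).1.

(** Lightness is asked only above depth [k], where [few] bounds the number of profiles; the range
    condition is asked for every history, so that all skeleton ports are legal. *)
Definition good_choice (h : seq nat) (beta : nat -> nat) : Prop :=
  (forall r, r < b -> beta r < Q) /\
  (size h < k -> forall D, D \in block_profiles fwd W M h ->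
     exists2 r, r < b & s * count_mem (r * Q + beta r) D <= size D).

Lemma good_choice_exists h : exists beta, good_choice h beta.
Proof.
have Q_gt0 : 0 < Q.
  by move: few; rewrite !lt0n; apply: contraTneq => ->; rewrite exp0n ?ltn0 // ltnW.
have [hk|hk] := ltnP (size h) k; last first.
  by exists (fun=> 0); split=> [//|]; rewrite ltnNge hk.
have [|beta [beta_lt betaP]] := @light_block_choice b s Q (block_profiles fwd W M h).
  apply: leq_ltn_trans few; rewrite leq_mul2r; apply/orP; right.
  apply: leq_trans (size_block_profiles _ _ _ _) _.
  by rewrite leq_exp2l // leq_mul2l hk orbT.
by exists beta.
Qed.

Variable beta : seq nat -> nat -> nat.
Hypothesis betaP : forall h, good_choice h (beta h).

(* The blocks used on the way from the root to the vertex with path [sg]. *)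
Fixpoint history (sg : seq nat) : seq nat :=
  if sg is r :: sg' then (r * Q + beta (history sg') r) :: history sg' else [::].

(** For [u] a proper ancestor of [w], the index of the child of [u] leading to [w]: in the upward
    path of [w] it stands just before the path of [u]. *)
Definition branch (u w : nat) : nat :=
  nth 0 (heap_path b w) (size (heap_path b w) - (size (heap_path b u)).+1).

(** For [w < W], the remainder modulo [W] is [w], which keeps ports distinct whatever the blocks;
    the quotient is the block index. *)
Definition skeleton_port (u w : nat) : nat :=
  (branch u w * Q + beta (history (heap_path b u)) (branch u w)) * W + w.

(** True even for unrelated [u] and [w], thanks to the default 0, so that every skeleton neighbour
    gets a port in range. *)
Lemma branch_lt u w : branch u w < b.
Proof.
rewrite /branch; set i := (_ - _); have [ip|ip] := ltnP i (size (heap_path b w)).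
  exact: (allP (heap_path_lt b_gt1 w)) (mem_nth 0 ip).
by rewrite nth_default // ltnW.
Qed.

Lemma skeleton_ports_exist (u : 'I_n) : exists g : 'I_n -> nat,
  [/\ {in [set w | overlay S u w] &, injective g},
      forall w, overlay S u w -> g w < #|[set w' | overlay S u w']|
    & u < W -> forall w : 'I_n, w < W -> overlay S u w -> g w = skeleton_port u w].
Proof.
pose B := if u < W then [set w : 'I_n | overlay S u w && (w < W)] else set0.
have [|w w'|w|g [ginj glt gE]] := @extend_ports _ [set w | overlay S u w] B
    (fun w : 'I_n => skeleton_port u w).
- rewrite /B; case: ifP => _; last exact: sub0set.
  by apply/subsetP => w; rewrite !inE => /andP[].
- rewrite /B; case: ifP => _; rewrite !inE // => /andP[_ wW] /andP[_ w'W].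
  move=> /(congr1 (modn^~ W)); rewrite /skeleton_port !modnMDl !modn_small //.
  exact: val_inj.
- rewrite /B; case: ifP => [uW|_]; rewrite !inE // => /andP[_ wW].
  apply: leq_trans (card_overlay_nbrs W_gt0 st1 uW deg_n).
  have [bl _] := betaP (history (heap_path b u)).
  by have br := branch_lt u w; exact: block_port_lt (bl _ br) wW.
exists g; split=> // [w uw|uW w wW uw]; first by apply: glt; rewrite inE.
by rewrite gE // /B uW inE uw.
Qed.

Variable p : ports 'I_n.
Hypothesis pA : port_assignment (overlay S) p.
Hypothesis pE : forall u w : 'I_n,
  u < W -> w < W -> overlay S u w -> p u w = skeleton_port u w.
Hypothesis small : forall u, total_memory S p u < M.

Lemma vertices_gt0 : 0 < n. Proof. by apply: leq_trans deg_n; rewrite muln_gt0 W_gt0. Qed.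

Definition vertex (sg : seq nat) : 'I_n := insubd (Ordinal vertices_gt0) (heap_node b sg).

Lemma heap_node_ltW sg : all (ltn^~ b) sg -> size sg <= k -> heap_node b sg < W.
Proof.
move=> sgb sgk; apply: leq_trans kW; apply: ltnW.
apply: leq_trans (heap_node_bound b_gt1 sgb) _.
by rewrite leq_pmul2l // leq_pexp2l // ltnW.
Qed.

Lemma val_vertex sg :
  all (ltn^~ b) sg -> size sg <= k -> vertex sg = heap_node b sg :> nat.
Proof.
move=> sgb sgk; rewrite val_insubd ifT //.
apply: leq_trans (heap_node_ltW sgb sgk) (leq_trans _ deg_n).
exact: leq_pmull.
Qed.

Lemma vertex_cons r sg : all (ltn^~ b) (r :: sg) -> size sg < k ->
  par (vertex (r :: sg)) = vertex sg.
Proof.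
move=> rsgb sgk; have /andP[rb sgb] := rsgb; apply: val_inj => /=.
rewrite val_heap_par // /heap_parent (val_vertex rsgb sgk) (val_vertex sgb (ltnW sgk)).
rewrite [_ < W](heap_node_ltW rsgb sgk) /= addnS /= divnMDl ?(ltnW b_gt1) //.
by rewrite divn_small // addn0.
Qed.

Let tbl sg := table S p (vertex sg).

(** The member of [label_classes] singled out by the actual tables of the ancestors. *)
Fixpoint surviving (sg : seq nat) : seq bits :=
  if sg is r :: sg' then
    [seq l <- surviving sg' | fwd (tbl sg') l %/ W == head 0 (history sg)]
  else short_bits M.

Lemma tbl_short sg : tbl sg \in short_bits M.
Proof. by apply/mem_short_bits/(leq_ltn_trans (leq_addr _ _))/small. Qed.

Lemma surviving_class sg : surviving sg \in label_classes fwd W M (history sg).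
Proof.
elim: sg => [|r sg IHsg]; first by rewrite inE.
by apply/allpairsP; exists (surviving sg, tbl sg); rewrite tbl_short.
Qed.

(** Lightness, applied to the profile of the actual table, yields the next child. The bound is
    strict from the start, as [short_bits M] has [2 ^ M - 1] elements. *)
Lemma shrinking_path i : i <= k -> exists sg,
  [/\ size sg = i, all (ltn^~ b) sg & s ^ i * size (surviving sg) < 2 ^ M].
Proof.
elim: i => [|i IHi] ik.
  by exists [::]; rewrite mul1n /= -size_short_bits.
have [sg [sz sgb le_sg]] := IHi (ltnW ik).
have [_] := betaP (history sg).
have -> : size (history sg) = i by rewrite -sz; elim: (sg) => //= r t ->.
move=> /(_ ik [seq fwd (tbl sg) l %/ W | l <- surviving sg])[|r rb].
  by apply/allpairsP; exists (surviving sg, tbl sg); rewrite surviving_class tbl_short.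
rewrite size_map => le_r; exists (r :: sg); split; rewrite /= ?sz ?rb //.
apply: leq_ltn_trans le_sg; rewrite expnSr -mulnA leq_mul2l; apply/orP; right.
by apply: leq_trans le_r; rewrite size_filter count_map.
Qed.

(** The prefix [rho] keeps the target fixed while the induction moves [sg] up to the root. *)
Lemma label_survives rho sg : all (ltn^~ b) (rho ++ sg) -> size (rho ++ sg) <= k ->
  label S p (vertex (rho ++ sg)) \in surviving sg.
Proof.
elim: sg rho => [|r sg IHsg] rho ab szk.
  by apply/mem_short_bits/(leq_ltn_trans (leq_addl _ _))/small.
(* Shifting [r] into the prefix settles the proper ancestors of [vertex sg]; the filter at
   [vertex sg] itself remains. *)
rewrite /= mem_filter; move: (ab) (szk); rewrite -cat_rcons => ab' szk'.
rewrite IHsg // andbT cat_rcons; set v := vertex _.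
have /andP[rhob rsgb] : all (ltn^~ b) rho && all (ltn^~ b) (r :: sg).
  by rewrite -all_cat.
have sgb : all (ltn^~ b) sg by case/andP: rsgb.
have sgk : size sg < k by apply: leq_trans szk; rewrite size_cat leq_addl.
pose c := vertex (r :: sg).
have vc : fconnect par v c.
  rewrite /v; elim: rho {v IHsg ab' szk'} ab szk rhob => [|q rho IH] //= ab szk.
  move=> /andP[_ rhob].
  apply: connect_trans (IH _ _ rhob); [|by case/andP: ab|exact: ltnW].
  by rewrite -(vertex_cons ab szk) fconnect1.
have vW : v < W by rewrite val_vertex // heap_node_ltW.
have uc : par c = vertex sg := vertex_cons rsgb sgk.
have uW : vertex sg < W by rewrite val_vertex ?heap_node_ltW // ltnW.
have c0 : c != 0 :> nat by rewrite val_vertex //= addnS.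
have uv : vertex sg != v.
  rewrite -uc; apply: contraTneq (heap_par_lt b W_gt0 c0) => ->.
  by rewrite -leqNgt (@fconnect_heap_par_le b W n).
have [w [uw fw le_w]] :=
  routed_first_hop (heap_tree_connect b W_gt0) (st1 pA _ _) uv.
have wc : w != par c.
  by rewrite uc; apply: contraTneq uw => ->; rewrite overlay_irrefl.
rewrite -uc in le_w; have /andP[{}wc vw] 
    := heap_between W_gt0 vc wc le_w.
(* Ancestors have no larger index, so the hop [w] lies in the skeleton and its port is
   prescribed. *)
have wW : w < W by apply: leq_ltn_trans vW; apply: (@fconnect_heap_par_le b W n).
rewrite /fwd /tbl fw (pE uW wW uw) /skeleton_port divnMDl // divn_small // addn0.
have [tau wE] := heap_path_ancestor wW wc.
have uE : heap_path b (vertex sg) = sg by rewrite val_vertex ?heap_nodeK // ltnW.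
have cE : heap_path b c = r :: sg by rewrite val_vertex ?heap_nodeK.
have brE : branch (vertex sg) w = r.
  by rewrite /branch wE cE uE size_cat /= addnK nth_cat ltnn subnn.
by rewrite brE uE.
Qed.

(** The label of the vertex reached at depth [k] survives, so at least one label does, against
    [2 ^ M <= s ^ k]. *)
Lemma adversary_contradiction : False.
Proof.
have [sg [sz sgb]] := shrinking_path (leqnn k).
have := @label_survives [::] sg; rewrite sz /= => /(_ sgb (leqnn k)).
case: (surviving sg) => // l L _; rewrite ltnNge => /negP; apply.
by apply: leq_trans Msk _; rewrite leq_pmulr.
Qed.
End Adversary.

(** The skeleton has [W] vertices and branching [b]; each child is offered [Q] blocks of [W] ports.
    Blocks are fixed as a function of the history alone, before any table is known. *)
Lemma heap_tree_memory b W s Q M k n (S : routing_scheme 'I_n) :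
    1 < b -> 0 < W -> 2 * b ^ k <= W -> (b * Q * W).+1 * W <= n ->
    2 ^ (M * k) * s ^ b < Q ^ b -> 2 ^ M <= s ^ k ->
    stretch1 (graph_dist (@heap_tree b W n)) S ->
  exists2 p, port_assignment (overlay S) p & exists u, M <= total_memory S p u.
Proof.
move=> b_gt1 W_gt0 kW deg_n few Msk st1.
have [beta betaP] := choice (good_choice_exists W b_gt1 few S).
have [p pP] := choice (skeleton_ports_exist b_gt1 W_gt0 deg_n st1 betaP).
have pA : port_assignment (overlay S) p by move=> u; have [] := pP u.
exists p => //.
have [/existsP//|/existsPn small] := boolP [exists u, M <= total_memory S p u].
case: (adversary_contradiction b_gt1 W_gt0 kW deg_n Msk st1 betaP pA).
  by move=> u w uW wW uw; have [_ _] := pP u; apply.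
by move=> u; rewrite ltnNge small.
Qed.

(** * Choice of the parameters *)

Definition tree_scale (n : nat) : nat := trunc_log 2 n %/ 7.
(** Makes the branching [2 ^ branching_log a] exceed [a ^ 2], hence the square of the depth. *)
Definition branching_log (a : nat) : nat := 2 * (trunc_log 2 a).+1.
Definition tree_depth (a : nat) : nat := a.-1 %/ branching_log a.

Definition hard_tree (n : nat) : rel 'I_n :=
  @heap_tree (2 ^ branching_log (tree_scale n)) (2 ^ tree_scale n) n.

Lemma hard_tree_memory n (a := tree_scale n) (S : routing_scheme 'I_n) :
    0 < a -> stretch1 (graph_dist (@hard_tree n)) S ->
  exists2 p, port_assignment (overlay S) p &
    exists u, a * tree_depth a <= total_memory S p u.
Proof.
move=> a_gt0; set j := branching_log a; set k := tree_depth a.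
have lt_a : a < 2 ^ (trunc_log 2 a).+1 by exact: trunc_log_ltn.
have le_a : 2 ^ trunc_log 2 a <= a by exact: trunc_logP.
have log_a : trunc_log 2 a < a := leq_trans (ltn_expl _ (ltnSn 1)) le_a.
have kj : k * j <= a.-1 by exact: leq_divM.
have k_lt : k * k < 2 ^ j.
  have ka : k <= a by apply: leq_trans (leq_div _ _) (leq_pred _).
  rewrite /j /branching_log mulnC expnM -mulnn.
  apply: leq_ltn_trans (leq_mul ka ka) _.
  by rewrite ltn_mul.
have n_gt0 : 0 < n.
  by move: a_gt0; rewrite /a /tree_scale; case: (n) => //; rewrite trunc_log0.
have le_n : 2 ^ (7 * a) <= n.
  apply: leq_trans (trunc_logP (ltnSn 1) n_gt0).
  by rewrite leq_exp2l // mulnC leq_divM.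
apply: (@heap_tree_memory (2 ^ j) (2 ^ a) (2 ^ a) (2 ^ (2 * a)) _ k).
- by rewrite -[1]/(2 ^ 0) ltn_exp2l.
- by rewrite expn_gt0.
- rewrite -expnM -expnS leq_exp2l // mulnC.
  by apply: leq_ltn_trans kj _; rewrite ltn_predL.
(* The exponent is [j + 4 * a + 1] with [j <= 2 * a], which explains the divisor 7 in
   [tree_scale]. *)
- apply: leq_trans le_n; rewrite -!expnD (@leq_trans (2 ^ (j + 2 * a + a).+1 * 2 ^ a)) //.
    rewrite leq_mul2r expnS; apply/orP; right.
    by rewrite ltn_Pmull ?expn_gt0.
  rewrite -expnD leq_exp2l //; move: log_a; rewrite /j /branching_log; lia.
(* With memory bound [a * k], comparing exponents reduces this to [k * k < 2 ^ j]. *)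
- rewrite -!expnM -expnD ltn_exp2l //.
  by rewrite -mulnA [2 * a * _]mulnC; nia.
- by rewrite expnM.
Qed.

(** * Passage to natural logarithms *)

Import Order.TTheory GRing.Theory Num.Theory.
Local Open Scope ring_scope.

Lemma ln2_ge_half (R : realType) : 1 / 2 <= ln (2 : R).
Proof.
have := @le_ln1Dx R (- (1 / 2)).
rewrite (_ : 1 + _ = 2^-1); last by lra.
rewrite lnV ?posrE //; lra.
Qed.

Lemma ln2_le1 (R : realType) : ln (2 : R) <= 1.
Proof. by have := @le_ln1Dx R 1; rewrite -[1 + 1]/2; apply; lra. Qed.

Lemma ln_exp2 (R : realType) m : ln ((2 ^ m)%N%:R : R) = ln 2 * m%:R.
Proof. by rewrite natrX lnXn // mulr_natr. Qed.

Theorem theorem1p9 (R : realType) :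
  exists T : forall n : nat, rel 'I_n,
    (forall n : nat, (0 < n)%N -> is_tree (T n)) /\
    exists (c : R) (N : nat),
      0 < c /\
      forall n : nat, (N <= n)%N ->
      forall S : routing_scheme 'I_n,
        stretch1 (graph_dist (T n)) S ->
        exists2 p : ports 'I_n, port_assignment (overlay S) p &
        exists u : 'I_n,
          c * (ln n%:R ^+ 2 / ln (ln n%:R)) <= (total_memory S p u)%:R.
Proof.
exists hard_tree; split=> [n n_gt0|].
  by apply: heap_tree_is_tree; rewrite ?expn_gt0.
(* Here [768 = 64 * 12]: squaring [ln n <= 8 * a] gives 64, and [a <= 12 * k * ln a] gives 12. The
   threshold ensures [a >= 64], hence positive depth. *)
exists (1 / 768), (2 ^ (7 * 64))%N; split; first by lra.
move=> n le_n S st1; pose a := tree_scale n.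
have n_gt0 : (0 < n)%N by apply: leq_trans le_n; rewrite expn_gt0.
have a64 : (64 <= a)%N.
  by rewrite leq_divRL // mulnC trunc_log_max.
(* The huge numeral in [le_n] would make [lra] run out of memory. *)
clear le_n.
have [p pA [u memu]] := hard_tree_memory (leq_trans (isT : (0 < 64)%N) a64) st1.
exists p => //; exists u; rewrite -/a in memu.
set k := tree_depth a in memu.
apply: le_trans (_ : (a * k)%N%:R <= _); last by rewrite ler_nat.
set l := trunc_log 2 a.
have le_a : (2 ^ l <= a)%N by apply: trunc_logP => //; lia.
have l6 : (6 <= l)%N by rewrite trunc_log_max.
(* As [k >= 1], rounding down in [tree_depth] loses at most a factor 2. *)
have a_le : (a <= 2 * k * (2 * l.+1))%N.
  have jlt : (2 * l.+1 <= a.-1)%N.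
    have := ltn_expl (l - 2) (ltnSn 1).
    move: le_a; rewrite -{1}(subnK (leq_trans (isT : 2 <= 6)%N l6)) expnD.
    by lia.
  have : (a.-1 < k.+1 * (2 * l.+1))%N.
    rewrite /k /tree_depth /branching_log -/l; exact: ltn_ceil.
  have : (0 < k)%N by rewrite /k /tree_depth divn_gt0.
  nia.
have lt_n : (n <= 2 ^ (8 * a))%N.
  apply: leq_trans (ltnW (trunc_log_ltn n (ltnSn 1))) _; rewrite leq_exp2l //.
  have : (trunc_log 2 n < a.+1 * 7)%N by exact: ltn_ceil.
  lia.
have ge_n : (2 ^ (7 * a) <= n)%N.
  apply: leq_trans (trunc_logP (ltnSn 1) n_gt0).
  by rewrite leq_exp2l // mulnC leq_divM.
have ln_mono (x y : nat) : (0 < x)%N -> (x <= y)%N -> ln (x%:R : R) <= ln y%:R.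
  by move=> x0 xy; rewrite ler_ln ?posrE ?ltr0n ?ler_nat //; lia.
have l2 := ln2_ge_half R; have l2' := ln2_le1 R.
have := ln_mono _ _ n_gt0 lt_n; have := ln_mono _ _ _ ge_n; rewrite !ln_exp2 expn_gt0.
have := ln_mono _ _ _ le_a; rewrite ln_exp2 expn_gt0 => /(_ isT).
have aR : 64 <= (a%:R : R) by rewrite (ler_nat _ 64).
have lR : 6 <= (l%:R : R) by rewrite (ler_nat _ 6).
have kR : 0 <= (k%:R : R) by [].
have : (a%:R : R) <= 2 * k%:R * (2 * (l%:R + 1)).
  by rewrite natr1 -!natrM ler_nat.
rewrite !natrM; move: (ln 2) l2 l2' => L L1 L2 a_leR lna /(_ isT) lnn1 lnn2.
have La : 1 / 2 * a%:R <= L * a%:R by rewrite ler_wpM2r.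
have La' : L * a%:R <= 1 * a%:R by rewrite ler_wpM2r.
have Ll : 1 / 2 * l%:R <= L * l%:R by rewrite ler_wpM2r.
have lnn : a%:R <= ln (n%:R : R) by lra.
have lnn8 : ln (n%:R : R) <= 8 * a%:R by lra.
have lnlnn : ln (a%:R : R) <= ln (ln n%:R) by rewrite ler_ln ?posrE //; lra.
move: (ln (ln n%:R)) lnlnn => y zy.
move: (ln n%:R) (ln a%:R) lnn lnn8 lna zy {lnn1 lnn2} => x z xa x8 lz zy.
have z1 : 3 <= z by lra.
(* [l <= 2 * z] because [ln 2 >= 1 / 2], and [z >= 3] absorbs the added 1. *)
have kl : k%:R * (l%:R + 1) <= k%:R * (3 * z) by rewrite ler_wpM2l //; lra.
have az : a%:R <= 12 * k%:R * z by lra.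
rewrite mulrA ler_pdivrMr; last lra.
have x2 : x ^+ 2 <= (8 * a%:R) ^+ 2 by rewrite lerXn2r ?nnegrE //; lra.
rewrite exprMn in x2.
have : a%:R ^+ 2 <= a%:R * (12 * k%:R * z) by rewrite expr2 ler_wpM2l.
have : a%:R * k%:R * z <= a%:R * k%:R * y by rewrite ler_wpM2l // mulr_ge0.
lra.
Qed.
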